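(* Let $(\mathfrak{A}, G, \Theta)$ be a C*-dynamical system, where $\mathfrak{A}$ is a nonzero separable unital C*-algebra and $G$ is a countable discrete amenable group, and let $\mathcal{F} = (F_k)_{k=1}^\infty$ be a right Følner sequence for $G$. If $a \in \mathfrak{A}$ is a positive element, then the sequence $$\left( \left\| \frac{1}{|F_k|} \sum_{g \in F_k} \Theta_g a \right\| \right)_{k=1}^\infty$$ converges to $m(a \vert \mathcal{S}^G)$.
   Context: A C*-dynamical system $(\mathfrak{A}, G, \Theta)$ consists of a unital C*-algebra $\mathfrak{A}$, a topological group $G$, and a group homomorphism $\Theta : G \to \operatorname{Aut}(\mathfrak{A})$, $g \mapsto \Theta_g$, into the *-automorphisms of $\mathfrak{A}$ which is continuous for the point-norm topology (automatic for discrete $G$). $\mathcal{S}^G$ denotes the set of $\Theta$-invariant states on $\mathfrak{A}$, i.e. states $\phi$ with $\phi \circ \Theta_g = \phi$ for all $g \in G$ (nonempty under the present hypotheses). For a self-adjoint $x \in \mathfrak{A}$ and a weak*-compact convex $K \subseteq \mathcal{S}^G$, $m(x \vert K) := \sup_{\psi \in K} \psi(x)$. A right Følner sequence for $G$ is a sequence $(F_k)_{k=1}^\infty$ of nonempty finite subsets of $G$ such that $|F_k g \Delta F_k|/|F_k| \to 0$ as $k \to \infty$ for every $g \in G$. *)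

(* Defs.v *)
From HB Require Import structures.
From mathcomp Require Import all_boot all_order all_algebra.
From mathcomp Require Import finmap.
From mathcomp Require Import all_classical all_reals all_analysis.
From mathcomp Require Import complex.

Set Implicit Arguments.
Unset Strict Implicit.
Unset Printing Implicit Defensive.

Import Order.TTheory GRing.Theory Num.Theory.
Import numFieldNormedType.Exports.

Local Open Scope classical_set_scope.
Local Open Scope ring_scope.

(* MathComp's [GRing.Algebra] and its normed modules cannot be joined on one
   carrier: the only rings with a norm there are the numeric domains.  So the
   norm is declared here, and [normed_space A] below is the type [A] seen as a
   normed module.  [GRing.Algebra] only provides nonzero rings, hence all
   C*-algebras below are nonzero. *)
HB.mixin Record Algebra_hasCstarNorm (R : realType) A of GRing.Algebra R[i] A := {
  star : A -> A ;
  cnorm : A -> R ;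
  starK : involutive star ;
  starD : forall x y, star (x + y) = star x + star y ;
  starZ : forall (c : R[i]) x, star (c *: x) = conjc c *: star x ;
  starM : forall x y, star (x * y) = star y * star x ;
  cnormD : forall x y, cnorm (x + y) <= cnorm x + cnorm y ;
  cnormZ : forall (c : R[i]) x, cnorm (c *: x) = complex.Re `|c| * cnorm x ;
  cnorm_eq0 : forall x, cnorm x = 0 -> x = 0 ;
  cnormM : forall x y, cnorm (x * y) <= cnorm x * cnorm y ;
  cnorm_star : forall x, cnorm (star x * x) = cnorm x ^+ 2
}.

#[short(type="preCstarAlgType")]
HB.structure Definition PreCstarAlgebra (R : realType) :=
  {A of GRing.Algebra R[i] A & Algebra_hasCstarNorm R A}.

Definition normed_space (R : realType) (A : preCstarAlgType R) : Type := A.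

Section NormedSpace.
Variables (R : realType) (A : preCstarAlgType R).

Let norm (x : normed_space A) : R[i] := (cnorm (x : A))%:C%C.

HB.instance Definition _ := GRing.Lmodule.copy (normed_space A) A.

Let normD (x y : normed_space A) : norm (x + y) <= norm x + norm y.
Proof. by rewrite /norm -rmorphD lecR; exact: cnormD. Qed.

Let normZ (c : R[i]) (x : normed_space A) : norm (c *: x) = `|c| * norm x.
Proof. by rewrite /norm cnormZ rmorphM -[X in _ = X * _](RRe_real (normr_real c)). Qed.

Let norm_eq0 (x : normed_space A) : norm x = 0 -> x = 0.
Proof. by move=> /(congr1 (@complex.Re R)); exact: cnorm_eq0. Qed.

HB.instance Definition _ :=
  Lmodule_isNormed.Build R[i] (normed_space A) normD normZ norm_eq0.

End NormedSpace.

HB.mixin Record PreCstarAlgebra_isComplete (R : realType) A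
    of PreCstarAlgebra R A := {
  cnorm_complete : forall F : set_system (normed_space A),
    ProperFilter F -> cauchy F -> cvg F
}.

#[short(type="unitalCstarAlgType")]
HB.structure Definition UnitalCstarAlgebra (R : realType) :=
  {A of PreCstarAlgebra R A & PreCstarAlgebra_isComplete R A}.

HB.instance Definition _ (R : realType) (A : unitalCstarAlgType R) :=
  Uniform_isComplete.Build (normed_space A) (@cnorm_complete R A).

Definition separable (T : topologicalType) : Prop :=
  exists2 D : set T, countable D & dense D.

Section CstarAlgebra.
Variables (R : realType) (A : unitalCstarAlgType R).

Definition selfadjoint (x : A) : Prop := star x = x.

Definition invertible (x : A) : Prop := exists y : A, x * y = 1 /\ y * x = 1.

Definition spectrum (x : A) : set R[i] := [set l | ~ invertible (l%:A - x)].

(* [0 <= l] in [R[i]] says that [l] is real and nonnegative. *)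
Definition positive_element (x : A) : Prop :=
  selfadjoint x /\ forall l, spectrum x l -> 0 <= l.

Definition star_automorphism (f : A -> A) : Prop :=
  [/\ bijective f,
      linear f,
      f 1 = 1,
      {morph f : x y / x * y} &
      {morph f : x / star x}].

Definition state (phi : A -> R[i]) : Prop :=
  [/\ scalar phi,
      forall x, positive_element x -> 0 <= phi x &
      phi 1 = 1].

(* States are real on self-adjoint elements, so for self-adjoint [x] taking real
   parts loses nothing.  [sup] is 0 by convention on an empty or unbounded set;
   for a nonempty set [K] of states the supremum is a genuine one. *)
Definition m_sup (x : A) (K : set (A -> R[i])) : R :=
  sup [set complex.Re (psi x) | psi in K].

End CstarAlgebra.

Section DynamicalSystem.
Variables (R : realType) (A : unitalCstarAlgType R) (G : groupType).

(* [G] is discrete, so point-norm continuity of [Theta] is no condition. *)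
Definition Cstar_dynamical_system (Theta : G -> A -> A) : Prop :=
  (forall g, star_automorphism (Theta g)) /\
  (forall g h, Theta (g * h)%g = Theta g \o Theta h).

Definition invariant_states (Theta : G -> A -> A) : set (A -> R[i]) :=
  [set phi | state phi /\ forall g, phi \o Theta g = phi].

Definition ergodic_average (Theta : G -> A -> A) (F : {fset G}) (a : A) : A :=
  (#|` F|%:R)^-1 *: \sum_(g <- F) Theta g a.

End DynamicalSystem.

Section Amenability.
Variables (R : realType) (G : groupType).

(* Von Neumann's definition for a discrete group: a finitely additive,
   left-invariant probability measure on all subsets of [G]. *)
Definition amenable : Prop :=
  exists mu : set G -> R,
    [/\ forall S, 0 <= mu S,
        mu [set: G] = 1,
        forall S T, S `&` T = set0 -> mu (S `|` T) = mu S + mu T &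
        forall (g : G) S, mu [set (g * x)%g | x in S] = mu S].

Definition fsymdiff (E F : {fset G}) : {fset G} :=
  ((E `\` F) `|` (F `\` E))%fset.

Definition right_translate (F : {fset G}) (g : G) : {fset G} :=
  [fset (x * g)%g | x in F]%fset.

Definition right_Folner (F : nat -> {fset G}) : Prop :=
  (forall k, F k != fset0) /\
  forall g : G,
    (fun k => #|` fsymdiff (right_translate (F k) g) (F k)|%:R / #|` F k|%:R : R)
      @ \oo --> (0 : R).

End Amenability.

(* Main.v *)
(* Write avg_k for the k-th ergodic average.  An invariant state [psi] satisfies
   psi(a) = psi(avg_k a) <= |avg_k a| for every k, so m(a | S^G) is a lower bound.
   For the upper bound, q(x) = limsup_k max spec (avg_k (Re x)) is sublinear, and
   q(Theta_g x - x) <= 0 by the Folner property.  Hahn-Banach gives a real-linear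
   f <= q with f(a) = q(a); its complexification is an invariant state, hence
   limsup_k |avg_k a| = q(a) = f(a) <= m(a | S^G).

   The order is handled through the cone of self-adjoint x with |r - x| <= r for
   some r, which is stable under sums.  Its elements have self-adjoint square
   roots, which also show that it contains all elements of nonnegative spectrum,
   without using the spectral radius formula. *)
From HB Require Import structures.
Require Import Defs.
From mathcomp Require Import all_boot all_order all_algebra.
From mathcomp Require Import finmap.
From mathcomp Require Import all_classical all_reals all_analysis.
From mathcomp Require Import complex.
From mathcomp Require Import ring lra.

Import Order.TTheory GRing.Theory Num.Theory.
Import numFieldNormedType.Exports.
Local Open Scope classical_set_scope.
Local Open Scope ring_scope.

Set Implicit Arguments.
Unset Strict Implicit.
Unset Printing Implicit Defensive.

(** * Sublinear functionals and the Hahn-Banach theorem over the reals *)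

Section HahnBanach.
Variables (R : realType) (V : lmodType R).
Implicit Types (p q : V -> R) (x y : V) (s t : R).

Definition sublinear p :=
  (forall x y, p (x + y) <= p x + p y) /\
  (forall t x, 0 <= t -> p (t *: x) <= t * p x).

Lemma sublinear0 p : sublinear p -> p 0 = 0.
Proof.
move=> [pD pZ]; apply/eqP; rewrite eq_le.
have := pZ 0 0 (lexx _); rewrite scale0r mul0r => ->.
by have := pD 0 0; rewrite addr0 lerDl => ->.
Qed.

Lemma sublinear_opp p x : sublinear p -> - p (- x) <= p x.
Proof.
move=> sp; have := sp.1 x (- x).
by rewrite subrr (sublinear0 sp) => ge0; rewrite -subr_ge0 opprK.
Qed.

(** For sublinear [p], the largest sublinear functional below [p] whose value at [- y] is at most
    [- p y]; a linear functional below it agrees with [p] at [y]. *)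
Definition tilt p y x : R :=
  inf [set p (x + t *: y) - t * p y | t in [set t | 0 <= t]].

Lemma tilt_le p y x t : sublinear p -> 0 <= t ->
  tilt p y x <= p (x + t *: y) - t * p y.
Proof.
move=> sp t0; apply: ge_inf; last by exists t.
(* The infimum is genuine: [s * p y <= p (s *: y) <= p (x + s *: y) + p (- x)]. *)
exists (- p (- x)) => _ [s /= s0 <-].
rewrite lerBrDr addrC -(lerD2r (p (- x))) subrK.
apply: le_trans (sp.1 _ _) => /=.
rewrite addrAC subrr add0r.
have [->|sn0] := eqVneq s 0; first by rewrite mul0r scale0r (sublinear0 sp).
have := sp.2 s^-1 (s *: y); rewrite scalerA mulVf // scale1r.
rewrite invr_ge0 => /(_ s0); rewrite mulrC ler_pdivlMr ?(mulrC (p y)) //.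
by rewrite lt_neqAle eq_sym sn0.
Qed.

Lemma le_tilt p y x b :
  (forall t, 0 <= t -> b <= p (x + t *: y) - t * p y) -> b <= tilt p y x.
Proof.
move=> bp; apply: lb_le_inf; first by exists (p (x + 0 *: y) - 0 * p y), 0 => //=.
by move=> _ [t t0 <-]; apply: bp.
Qed.

Lemma tilt_ler p y x : sublinear p -> tilt p y x <= p x.
Proof.
by move=> sp; have := @tilt_le p y x 0 sp (lexx _); rewrite scale0r addr0 mul0r subr0.
Qed.

Lemma tilt_sublinear p y : sublinear p -> sublinear (tilt p y).
Proof.
move=> sp; split=> [x1 x2|s x s0].
  rewrite -lerBlDr; apply: le_tilt => t t0; rewrite lerBlDr -lerBlDl.
  apply: le_tilt => s s0; rewrite lerBlDr.
  apply: (le_trans (@tilt_le _ _ _ (s + t) sp _)); first exact: addr_ge0.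
  have := sp.1 (x1 + t *: y) (x2 + s *: y).
  rewrite addrACA -scalerDl (addrC t) mulrDl.
  lra.
have [->|sn0] := eqVneq s 0.
  by have := tilt_ler y 0 sp; rewrite (sublinear0 sp) scale0r mul0r.
have s_gt0 : 0 < s by rewrite lt_neqAle eq_sym sn0.
rewrite mulrC -ler_pdivrMr //. apply: le_tilt => t t0.
rewrite ler_pdivrMr //.
apply: (le_trans (@tilt_le _ _ _ (s * t) sp _)); first exact: mulr_ge0.
have := sp.2 s (x + t *: y) s0; rewrite scalerDr scalerA; lra.
Qed.

(* A pointwise minimal sublinear functional [f] is linear: [tilt f y <= f] is
   sublinear, hence equal to [f], and [tilt f y x <= f (x + y) - f y]. *)
Theorem hahn_banach p a : sublinear p ->
  exists f : V -> R, [/\ scalar f, forall x, f x <= p x & f a = p a].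
Proof.
(* Minimizing below [tilt p a] instead of [p] forces [f (- a) <= - p a], hence [f a = p a]. *)
move=> sp; have sq := @tilt_sublinear p a sp; set q := tilt p a in sq.
pose T := {f : V -> R | sublinear f /\ forall x, f x <= q x}.
(* The order is reversed, so that Zorn's maximal element is pointwise minimal. *)
pose below (f g : T) := `[< forall x, sval g x <= sval f x >].
have [||||[f [sf fq]] fmin] := @Zorn T below.
- by move=> f; apply/asboolP.
- move=> f g h /asboolP gf /asboolP hg; apply/asboolP => x.
  exact: le_trans (hg x) (gf x).
- move=> [f hf] [g hg] /asboolP /= gf /asboolP /= fg.
  by apply: eq_exist; apply/funext => x; apply/eqP; rewrite eq_le fg gf.
- move=> C totC.
  have [[f0 Cf0]|C0] := pselect (exists f, C f); last first.
    by exists (exist _ q (conj sq (fun x => lexx (q x)))) => s Cs; case: C0; exists s.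
  (* A nonempty chain is bounded by its pointwise infimum, finite since
     [f x >= - f (- x) >= - q (- x)]. *)
  pose g x := inf [set sval f x | f in C].
  have gle f x : C f -> g x <= sval f x.
    move=> Cf; apply: ge_inf; last by exists f.
    exists (- q (- x)) => _ [[h [sh hq]] Ch <-] /=.
    by apply: le_trans (sublinear_opp x sh); rewrite lerN2.
  have leg b x : (forall f, C f -> b <= sval f x) -> b <= g x.
    move=> bf; apply: lb_le_inf; first by exists (sval f0 x), f0.
    by move=> _ [f Cf <-]; apply: bf.
  have sg : sublinear g.
    split=> [x y|t x t0].
      rewrite -lerBlDr; apply: (leg) => f Cf; rewrite lerBlDr -lerBlDl.
      apply: (leg) => h Ch; rewrite lerBlDr.
      (* The smaller of the two functionals serves for both terms. *)
      have [/asboolP hf|/asboolP fh] := totC _ _ Cf Ch.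
        apply: le_trans (gle _ _ Ch) _; apply: le_trans ((svalP h).1.1 _ _) _.
        by rewrite addrC lerD2l.
      apply: le_trans (gle _ _ Cf) _; apply: le_trans ((svalP f).1.1 _ _) _.
      by rewrite addrC lerD2r.
    have [->|tn0] := eqVneq t 0.
      rewrite scale0r mul0r; apply: le_trans (gle _ _ Cf0) _.
      by rewrite (sublinear0 (svalP f0).1).
    have t_gt0 : 0 < t by rewrite lt_neqAle eq_sym tn0.
    rewrite mulrC -ler_pdivrMr //; apply: (leg) => f Cf; rewrite ler_pdivrMr //.
    by apply: le_trans (gle _ _ Cf) _; rewrite mulrC; apply: (svalP f).1.2.
  have gq x : g x <= q x by apply: le_trans (gle _ _ Cf0) ((svalP f0).2 x).
  by exists (exist _ g (conj sg gq)) => s Cs; apply/asboolP => x /=; apply: gle.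
have tiltf y x : tilt f y x = f x.
  have tq z : tilt f y z <= q z by apply: le_trans (tilt_ler _ _ sf) (fq z).
  pose g : T := exist _ (tilt f y) (conj (tilt_sublinear y sf) tq).
  have /fmin/(congr1 (fun h : T => sval h x)) // : below (exist _ f (conj sf fq)) g.
  by apply/asboolP => z /=; apply: tilt_ler.
have fD x y : f (x + y) = f x + f y.
  apply/eqP; rewrite eq_le sf.1 /= -lerBrDr -{1}(tiltf y x).
  by have := @tilt_le f y x 1 sf ler01; rewrite scale1r mul1r.
have fN x : f (- x) = - f x.
  by apply/eqP; rewrite -addr_eq0 -fD addNr (sublinear0 sf).
have fZ_ge0 t x : 0 <= t -> f (t *: x) = t * f x.
  move=> t0; apply/eqP; rewrite eq_le sf.2 //=.
  by have := sf.2 t (- x) t0; rewrite scalerN !fN mulrN lerN2.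
have fZ t x : f (t *: x) = t * f x.
  have [/fZ_ge0//|/ltW t0] := leP 0 t.
  have := fZ_ge0 (- t) x.
  by rewrite oppr_ge0 scaleNr fN mulNr => /(_ t0)/oppr_inj.
have fp x : f x <= p x by apply: le_trans (fq x) (tilt_ler _ _ sp).
exists f; split => //; first by move=> t x y; rewrite fD fZ.
apply/eqP; rewrite eq_le fp /= -lerN2 -fN; apply: le_trans (fq _) _.
have := @tilt_le p a (- a) 1 sp ler01.
by rewrite scale1r addNr (sublinear0 sp) mul1r sub0r.
Qed.

End HahnBanach.

Local Notation "r %:S" := ((r%:C%C)%:A) (at level 1, format "r %:S").

(** * Norm and adjoint; limits of majorized iterations *)

Section Norm.
Variables (R : realType) (A : unitalCstarAlgType R).
Implicit Types (x y z : A) (r s : R).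

Lemma cnormZ_real r x : cnorm (r%:C%C *: x) = `|r| * cnorm x.
Proof. by rewrite cnormZ normc_def /= expr0n addr0 sqrtr_sqr. Qed.

Lemma cnormN x : cnorm (- x) = cnorm x.
Proof. by rewrite -scaleN1r cnormZ normrN1 mul1r. Qed.

Lemma cnorm0 : cnorm (0 : A) = 0.
Proof. by rewrite -[0 in LHS](scale0r (0 : A)) cnormZ normr0 mul0r. Qed.

Lemma cnorm_ge0 x : 0 <= cnorm x.
Proof. by have := cnormD x (- x); rewrite subrr cnorm0 cnormN -mulr2n pmulrn_lge0. Qed.

Lemma cnormB x y : cnorm (x - y) <= cnorm x + cnorm y.
Proof. by rewrite -(cnormN y) cnormD. Qed.

Lemma cnormC x y : cnorm (x - y) = cnorm (y - x).
Proof. by rewrite -cnormN opprB. Qed.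

Lemma star0 : star (0 : A) = 0.
Proof. by rewrite -[0 in LHS](scale0r (0 : A)) starZ rmorph0 scale0r. Qed.

Lemma starN x : star (- x) = - star x.
Proof. by rewrite -scaleN1r starZ rmorphN1 scaleN1r. Qed.

Lemma starB x y : star (x - y) = star x - star y.
Proof. by rewrite starD starN. Qed.

Lemma star1 : star (1 : A) = 1.
Proof. by rewrite -[LHS]mul1r -{1}[1]starK -starM mul1r starK. Qed.

Lemma starZ_real r x : star (r%:C%C *: x) = r%:C%C *: star x.
Proof. by rewrite starZ conjc_real. Qed.

Lemma star_real r : star (r%:S : A) = r%:S.
Proof. by rewrite starZ_real star1. Qed.

(** The C*-identity and submultiplicativity give [|y|^2 <= |star y| |y|]; the other inequality
    follows by replacing [y] with [star y]. *)
Lemma cnorm_starE x : cnorm (star x) = cnorm x.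
Proof.
have le y : cnorm y <= cnorm (star y).
  have := cnormM (star y) y; rewrite cnorm_star expr2.
  have := cnorm_ge0 y; rewrite le_eqVlt => /predU1P[<- _|y0]; first exact: cnorm_ge0.
  by rewrite ler_pM2r.
by apply/eqP; rewrite eq_le le -{2}[x]starK le.
Qed.

Lemma cnorm1 : cnorm (1 : A) = 1.
Proof.
have n0 : cnorm (1 : A) != 0 by apply/eqP => /cnorm_eq0/eqP; rewrite oner_eq0.
by apply: (mulfI n0); rewrite mulr1 -expr2 -cnorm_star star1 mul1r.
Qed.

Lemma cnorm_real r : cnorm (r%:S : A) = `|r|.
Proof. by rewrite cnormZ_real cnorm1 mulr1. Qed.

Lemma cnorm_le_eps (C : R) x : (forall e, 0 < e -> cnorm x <= C * e) -> x = 0.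
Proof.
move=> xC; apply: cnorm_eq0; apply/eqP; rewrite eq_le cnorm_ge0 andbT.
apply/ler_addgt0Pl => e e0; rewrite addr0.
have C1 : 0 < `|C| + 1 by rewrite ltr_wpDl.
apply: le_trans (xC (e / (`|C| + 1)) _) _; first exact: divr_gt0.
rewrite mulrA ler_pdivrMr // mulrC ler_pM2l //.
by rewrite (le_trans (ler_norm C)) // lerDl.
Qed.

(** The sequence [q] is nondecreasing and bounded, and its increments dominate those of [u], so [u]
    is Cauchy. *)
Lemma majorized_seq_cvg (u : nat -> A) (q : nat -> R) (M : R) :
  (forall n, cnorm (u n.+1 - u n) <= q n.+1 - q n) -> (forall n, q n <= M) ->
  exists l : A, forall e, 0 < e -> \forall n \near \oo, cnorm (u n - l) < e.
Proof.
move=> uq qM.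
have uqD n k : cnorm (u (n + k)%N - u n) <= q (n + k)%N - q n.
  elim: k => [|k IH]; first by rewrite addn0 !subrr cnorm0.
  rewrite addnS -(subrKA (u (n + k)%N)) -(subrKA (q (n + k)%N)).
  by rewrite (le_trans (cnormD _ _)) // lerD.
have qsup : has_sup (range q) by split; [exists (q 0%N), 0%N | exists M => _ [n _ <-]].
pose v : nat -> normed_space A := u.
have : cauchy (v @ \oo).
  apply: cauchy_exP => -[e1 e2]; rewrite ltcE /= => /andP[/eqP -> e0].
  have [_ [N _ <-] qN] := sup_adherent e0 qsup.
  exists (v N); near=> n.
  rewrite -ball_normE /ball_ /= -[X in X < _]/((cnorm (u N - u n))%:C%C) ltcR.
  have /subnK nN : (N <= n)%N by near: n; exists N.
  rewrite cnormC -nN addnC (le_lt_trans (uqD _ _)) // ltrBlDl.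
  have : q (N + (n - N))%N <= sup (range q).
    by apply: ub_le_sup; [exact: qsup.2|exists (N + (n - N))%N].
  by move/le_lt_trans; apply; rewrite -ltrBlDr.
move=> /cauchy_cvg/cvg_ex[l vl]; exists l => e e0.
have e0C : 0 < (e%:C)%C :> R[i] by rewrite ltcR.
move/cvgrPdist_lt/(_ _ e0C): vl; apply: filterS => n.
by rewrite -[X in X < _]/((cnorm ((l : A) - u n))%:C%C) ltcR cnormC.
Unshelve. all: by end_near. Qed.

(* Kantorovich's majorant principle: the iterates of [f] from [0] are dominated
   by those of the scalar function [phi].  Closed linear conditions [L x = 0]
   preserved by [f] pass to the fixed point. *)
Lemma majorant_fixpoint (f : A -> A) (phi : R -> R) (M K : R) :
  0 <= M -> cnorm (f 0) <= phi 0 ->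
  (forall x y r s, cnorm x <= r -> cnorm y <= s -> cnorm (y - x) <= s - r ->
     cnorm (f y - f x) <= phi s - phi r) ->
  (forall r, 0 <= r <= M -> phi r <= M) ->
  (forall x y, cnorm x <= M -> cnorm y <= M ->
     cnorm (f x - f y) <= K * cnorm (x - y)) ->
  exists l : A, f l = l /\
    forall (L : A -> A) (C : R), (forall x y, L (x - y) = L x - L y) ->
      (forall x, cnorm (L x) <= C * cnorm x) ->
      (forall x, L x = 0 -> L (f x) = 0) -> L l = 0.
Proof.
move=> M0 f0 fphi phiM fK.
pose v n := iter n f 0; pose q n := iter n phi 0.
have vq n : [/\ cnorm (v n) <= q n, cnorm (v n.+1 - v n) <= q n.+1 - q n & 0 <= q n <= M].
  elim: n => [|n [vn dn /andP[qn0 qnM]]].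
    by split; rewrite ?cnorm0 ?subr0 ?lexx ?M0.
  have vS : cnorm (v n.+1) <= q n.+1.
    by rewrite -(subrK (v n) (v n.+1)) (le_trans (cnormD _ _)) // -(subrK (q n) (q n.+1)) lerD.
  split => //; first exact: fphi.
  by rewrite (le_trans (cnorm_ge0 _) vS) phiM // qn0.
have [n|n|l vl] := @majorized_seq_cvg v q M; [by have [] := vq n|by have [_ _ /andP[]] := vq n|].
have lM : cnorm l <= M.
  apply/ler_addgt0Pl => e e0.
  have [n vnl] := filter_ex (vl e e0).
  have [vn _ /andP[_ qnM]] := vq n.
  rewrite -(subKr (v n) l) (le_trans (cnormB _ _)) // addrC lerD //.
    exact: ltW.
  exact: le_trans qnM.
(* Since [f (v n) = v n.+1], the Lipschitz bound carries the fixed point equation to the limit. *)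
exists l; split.
  apply/eqP; rewrite -subr_eq0; apply/eqP; apply: (@cnorm_le_eps (`|K| + 1)) => e e0.
  have [n [vnl vSnl]] : exists n, cnorm (v n - l) < e /\ cnorm (v n.+1 - l) < e.
    by have [N _ vlN] := vl e e0; exists N; split; apply: vlN => /=.
  have [vn _ /andP[_ qnM]] := vq n.
  rewrite -(subrKA (v n.+1)) (le_trans (cnormD _ _)) // mulrDl mul1r lerD ?(ltW vSnl) //.
  rewrite (le_trans (fK _ _ lM (le_trans vn qnM))) // cnormC.
  rewrite (le_trans (ler_wpM2r (cnorm_ge0 _) (ler_norm K))) //.
  by rewrite ler_wpM2l // ltW.
move=> L C LB LC Lf.
have L0 : L 0 = 0 by rewrite -[X in L X](subrr (0 : A)) LB subrr.
have Lv n : L (v n) = 0 by elim: n => //= n IH; apply: Lf.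
apply: (@cnorm_le_eps `|C|) => e e0; have [n vnl] := filter_ex (vl e e0).
rewrite -[L l]subr0 -(Lv n) -LB (le_trans (LC _)) // cnormC.
rewrite (le_trans (ler_wpM2r (cnorm_ge0 _) (ler_norm C))) //.
by rewrite ler_wpM2l // ltW.
Qed.

End Norm.

Lemma subrBB (V : zmodType) (x y z t : V) : x - y - (z - t) = x - z - (y - t).
Proof. by rewrite !opprB addrACA [RHS]addrACA; congr (_ + _); exact: addrC. Qed.

(** * Invertibility, square roots and the positive cone *)

Section Cone.
Variables (R : realType) (A : unitalCstarAlgType R).
Implicit Types (x y z h k : A) (r s t : R).

Lemma realD r s : ((r + s)%:S : A) = r%:S + s%:S.
Proof. by rewrite rmorphD scalerDl. Qed.

Lemma realB r s : ((r - s)%:S : A) = r%:S - s%:S.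
Proof. by rewrite rmorphB scalerBl. Qed.

(** The geometric series is the fixed point of [y |-> 1 + x y], majorized by [s |-> 1 + |x| s],
    whose own fixed point is [(1 - |x|)^-1]. *)
Lemma neumann x : cnorm x < 1 -> invertible (1 - x).
Proof.
move=> x1; have x1' : 0 < 1 - cnorm x by rewrite subr_gt0.
have [||y z r s _ _ yz|r /andP[_ rM]|y z _ _|l [fl Ll]] :=
  @majorant_fixpoint R A (fun y => 1 + x * y) (fun s => 1 + cnorm x * s)
    (1 - cnorm x)^-1 (cnorm x).
- by rewrite invr_ge0 ltW.
- by rewrite !mulr0 !addr0 cnorm1.
- rewrite opprD addrACA subrr add0r -mulrBr (le_trans (cnormM _ _)) //.
  by rewrite opprD addrACA subrr add0r -mulrBr ler_wpM2l // cnorm_ge0.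
- rewrite (le_trans (lerD (lexx 1) (ler_wpM2l (cnorm_ge0 x) rM))) //.
  by rewrite -[X in X + _](divff (lt0r_neq0 x1')) -mulrDl subrK mul1r.
- by rewrite opprD addrACA subrr add0r -mulrBr cnormM.
(* The fixed point equation gives only a right inverse; commutation with [x] makes it two-sided. *)
have xl : l * x = x * l.
  apply/eqP; rewrite -subr_eq0; apply/eqP.
  apply: (Ll (fun y => y * x - x * y) (cnorm x + cnorm x)) => [y z|y|y yx].
  - by rewrite mulrBl mulrBr subrBB.
  - rewrite (le_trans (cnormB _ _)) // mulrDl lerD ?cnormM //.
    by rewrite mulrC cnormM.
  rewrite mulrDl mulrDr mul1r mulr1 opprD addrACA subrr add0r.
  by rewrite -mulrA -mulrBr yx mulr0.
have lE : l - x * l = 1 by rewrite -{1}fl addrK.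
by exists l; rewrite mulrBl mulrBr mul1r mulr1 xl.
Qed.

Lemma invertible_sub (c : R[i]) x :
  cnorm x < complex.Re `|c| -> invertible (c%:A - x).
Proof.
move=> xc; have c0 : c != 0.
  apply: contraTneq xc => ->; rewrite normr0 -leNgt; exact: cnorm_ge0.
have : cnorm (c^-1 *: x) < 1.
  have : complex.Re `|c^-1| * complex.Re `|c| = 1.
    have := congr1 (@cnorm R A) (scalerA c^-1 c 1).
    by rewrite mulVf // scale1r !cnormZ cnorm1 mulr1.
  have : 0 <= complex.Re `|c^-1|.
    by have := cnorm_ge0 (c^-1 *: (1 : A)); rewrite cnormZ cnorm1 mulr1.
  rewrite le_eqVlt => /predU1P[<-|ci0 <-].
    by rewrite mul0r => /esym/eqP; rewrite oner_eq0.
  by rewrite cnormZ ltr_pM2l.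
move=> /neumann[y [xy yx]].
have -> : c%:A - x = c *: (1 - c^-1 *: x) by rewrite scalerBr scalerA divff // scale1r.
by exists (c^-1 *: y); rewrite -!scalerAl -!scalerAr !scalerA mulVf // mulfV // xy yx scale1r.
Qed.

(** Arens' trick: shift both [x] and [c = s + i t] by [i e]. By the C*-identity
    [|x + i e|^2 <= |x|^2 + e^2], and [e = |x|^2 / (2 t)] makes this smaller than
    [(t + e)^2 = t^2 + |x|^2 + e^2]. *)
Lemma invertible_imag (c : R[i]) x :
  star x = x -> complex.Im c != 0 -> invertible (c%:A - x).
Proof.
case: c => s t xs /= t0; pose e := cnorm x ^+ 2 / t / 2.
pose y := x + (0 +i* e)%C%:A.
have -> : (s +i* t)%C%:A - x = (s +i* (t + e))%C%:A - y.
  rewrite /y opprD addrA addrAC -scalerBl; congr (_%:A - _).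
  by apply/eqP; rewrite eq_complex /= subr0 addrK !eqxx.
have ys : star y = x - (0 +i* e)%C%:A.
  rewrite starD starZ star1 xs -scaleNr; congr (_ + _ *: _).
  by apply/eqP; rewrite eq_complex /= oppr0 !eqxx.
have yy : star y * y = x * x + (e ^+ 2)%:S.
  rewrite ys /y mulrDr !mulrBl -!scalerAl -!scalerAr !mul1r mulr1 addrA subrK scalerA.
  rewrite -scaleNr; congr (_ + _ *: _).
  by apply/eqP; rewrite eq_complex /=; apply/andP; split; apply/eqP; ring.
apply: invertible_sub; rewrite -(@ltr_pXn2r _ 2) ?nnegrE ?cnorm_ge0 //; last first.
  by rewrite normc_def /= sqrtr_ge0.
rewrite -cnorm_star yy normc_def /= sqr_sqrtr ?addr_ge0 ?sqr_ge0 //.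
rewrite (le_lt_trans (cnormD _ _)) // cnorm_real ger0_norm ?sqr_ge0 //.
rewrite (le_lt_trans (lerD (cnormM _ _) (lexx _))) //.
have -> : (t + e) ^+ 2 = t ^+ 2 + cnorm x ^+ 2 + e ^+ 2 by rewrite /e; field.
rewrite -expr2 addrA ltrD2r addrA ltrDr.
by rewrite ltr_wpDl ?sqr_ge0 // exprn_even_gt0.
Qed.

Lemma cnorm_sqrB x y :
  cnorm (x * x - y * y) <= (cnorm x + cnorm y) * cnorm (x - y).
Proof.
have -> : x * x - y * y = x * (x - y) + (x - y) * y.
  by rewrite mulrBr mulrBl addrA subrK.
rewrite (le_trans (cnormD _ _)) // [leRHS]mulrDl lerD ?cnormM //.
by rewrite mulrC cnormM.
Qed.

(* The iteration [v <- (u + v v) / 2] converges to [1 - sqrt (1 - u)]. *)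
Lemma sqrt_one_sub (u : A) : star u = u -> cnorm u <= 1 ->
  exists w : A, [/\ star w = w, w * w = 1 - u & forall z, z * u = u * z -> z * w = w * z].
Proof.
move=> us u1; pose f v : A := (2^-1)%:C%C *: (u + v * v).
have fB x y : cnorm (f x - f y) <= 2^-1 * ((cnorm x + cnorm y) * cnorm (x - y)).
  rewrite -scalerBr opprD addrACA subrr add0r cnormZ_real ger0_norm ?invr_ge0 //.
  by rewrite ler_wpM2l ?invr_ge0 // cnorm_sqrB.
(* The majorant [s |-> (1 + s^2) / 2] maps [0, 1] to itself, with fixed point 1. *)
have [||x y r s xr ys xy|r /andP[r0 r1]|x y x1 y1|v [fv Lv]] :=
  @majorant_fixpoint R A f (fun s => 2^-1 * (1 + s * s)) 1 1.
- by [].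
- rewrite /f !mulr0 !addr0 cnormZ_real ger0_norm ?invr_ge0 //.
  by rewrite mulr1 -[leRHS]mulr1 ler_wpM2l // invr_ge0.
- rewrite (le_trans (fB _ _)) // -mulrBr ler_wpM2l ?invr_ge0 //.
  have -> : 1 + s * s - (1 + r * r) = (s + r) * (s - r) by ring.
  apply: ler_pM => //; rewrite ?addr_ge0 ?cnorm_ge0 //.
  by rewrite lerD.
- by nra.
- rewrite (le_trans (fB _ _)) // mulrA ler_wpM2r ?cnorm_ge0 //; lra.
(* The adjoint is only conjugate linear, but [star y - y] is additive and bounded, as the fixed
   point principle asks. *)
have vs : star v = v.
  apply/eqP; rewrite -subr_eq0; apply/eqP.
  apply: (Lv (fun y => star y - y) 2) => [y z|y|y /eqP]; last first.
  - rewrite subr_eq0 => /eqP ys.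
    by rewrite starZ_real starD starM ys us subrr.
  - by rewrite (le_trans (cnormB _ _)) // cnorm_starE -mulr2n mulr_natl.
  by rewrite starB subrBB.
exists (1 - v); split.
- by rewrite starB star1 vs.
- have /(congr1 (fun y => y + y)) := fv.
  rewrite -scalerDl -rmorphD -[2^-1]div1r -splitr scale1r => uv.
  have -> : u = v + v - v * v by rewrite -uv addrK.
  by rewrite mulrBl !mulrBr !mul1r mulr1 -addrA -opprD addrA.
move=> z zu; rewrite mulrBl mulrBr mul1r mulr1; congr (_ - _).
apply/eqP; rewrite -subr_eq0; apply/eqP.
apply: (Lv (fun y => z * y - y * z) (cnorm z + cnorm z)) => [x y|y|y /eqP].
- by rewrite mulrBl mulrBr subrBB.
- rewrite (le_trans (cnormB _ _)) // mulrDl lerD ?cnormM //.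
  by rewrite mulrC cnormM.
rewrite subr_eq0 => /eqP zy.
by rewrite -scalerAr -scalerAl mulrDr mulrDl zu mulrA zy -mulrA zy mulrA subrr.
Qed.

Lemma scale_sqrt r x : 0 <= r ->
  ((Num.sqrt r)%:C%C *: x) * ((Num.sqrt r)%:C%C *: x) = r%:C%C *: (x * x).
Proof.
by move=> r0; rewrite -scalerAl -scalerAr scalerA -rmorphM -expr2 sqr_sqrtr.
Qed.

(* [h + i k] is [sqrt r] times a unitary, and [h] is its real part. *)
Lemma cnorm_sqr_sum h k r : star h = h -> star k = k -> h * k = k * h ->
  h * h + k * k = r%:S -> cnorm h ^+ 2 <= `|r|.
Proof.
move=> hs ks hk hkr; pose b := h + 'i%C *: k.
have bs : star b = h - 'i%C *: k.
  rewrite starD starZ hs ks -scaleNr; congr (_ + _ *: _).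
  by apply/eqP; rewrite eq_complex /= oppr0 !eqxx.
have : star b * b = r%:S.
  rewrite bs mulrDr !mulrBl -!scalerAl -!scalerAr hk addrA subrK scalerA.
  rewrite -scaleNr -hkr; congr (_ + _).
  rewrite -[RHS]scale1r; congr (_ *: _).
  by apply/eqP; rewrite eq_complex /=; apply/andP; split; apply/eqP; ring.
move=> /(congr1 (@cnorm R A)); rewrite cnorm_star cnorm_real => <-.
rewrite ler_pXn2r ?nnegrE ?cnorm_ge0 //.
have -> : h = (2^-1)%:C%C *: (b + star b).
  rewrite bs addrACA subrr addr0 scalerDr -scalerDl -rmorphD.
  by rewrite -[2^-1]div1r -splitr scale1r.
rewrite cnormZ_real ger0_norm ?invr_ge0 // mulrC ler_pdivrMr //.
by rewrite (le_trans (cnormD _ _)) // cnorm_starE -mulr2n mulr_natr.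
Qed.

(* For self-adjoint [x], [|r - x| <= r] says that the spectrum lies in [0, 2r]. *)
Definition cone x := star x = x /\ exists r, cnorm (r%:S - x) <= r.

(** After division by a positive radius [s], [x = s (1 - u)] with [|u| <= 1], and [1 - u] has a
    root. *)
Lemma cone_sqrt x : cone x ->
  exists h, [/\ star h = h, h * h = x & forall z, z * x = x * z -> z * h = h * z].
Proof.
(* The bound persists from [r] to [r + 1], which is positive even when [r] is 0. *)
move=> [xs [r xr]]; pose s := r + 1.
have s0 : 0 < s by rewrite ltr_wpDl // (le_trans (cnorm_ge0 _) xr).
have sn0 : s%:C%C != 0 :> R[i] by rewrite eq_complex /= gt_eqF.
have xs' : cnorm (s%:S - x) <= s.
  by rewrite realD addrAC (le_trans (cnormD _ _)) // cnorm_real normr1 lerD2r.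
have [||w [ws ww wz]] := @sqrt_one_sub ((s^-1)%:C%C *: (s%:S - x)).
- by rewrite starZ_real starB star_real xs.
- by rewrite cnormZ_real gtr0_norm ?invr_gt0 // mulrC ler_pdivrMr // mul1r.
exists ((Num.sqrt s)%:C%C *: w); split.
- by rewrite starZ_real ws.
- rewrite scale_sqrt ?(ltW s0) // ww scalerBr scalerA -rmorphM divff ?gt_eqF //.
  by rewrite scale1r opprB addrC subrK.
move=> z zx; rewrite -scalerAr wz ?scalerAl //.
by rewrite -scalerAr -scalerAl mulrBr mulrBl zx -scalerAr -scalerAl mulr1 mul1r.
Qed.

(** For [s > |h|^2] there is a root [k] of [s - h h] commuting with [h]. Then [h h + k k = s], hence
    [|s - h h| <= |k|^2 <= s]. *)
Lemma cone_sqr h : star h = h -> cone (h * h).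
Proof.
move=> hs; split; first by rewrite starM hs.
pose s := cnorm h ^+ 2 + 1; have s0 : 0 < s by rewrite ltr_wpDl ?sqr_ge0.
have [||w [ws ww wz]] := @sqrt_one_sub ((s^-1)%:C%C *: (h * h)).
- by rewrite starZ_real starM hs.
- rewrite cnormZ_real gtr0_norm ?invr_gt0 // mulrC ler_pdivrMr // mul1r.
  by rewrite (le_trans (cnormM _ _)) // -expr2 lerDl.
pose k := (Num.sqrt s)%:C%C *: w.
have kk : k * k = s%:S - h * h.
  rewrite scale_sqrt ?(ltW s0) // ww scalerBr scalerA -rmorphM divff ?gt_eqF //.
  by rewrite scale1r.
exists s; rewrite -kk (le_trans (cnormM _ _)) // -expr2 -[leRHS]gtr0_norm //.
apply: (@cnorm_sqr_sum _ h); rewrite ?kk ?subrK //.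
  by rewrite starZ_real ws.
by rewrite /k -scalerAl -scalerAr wz // -scalerAr -scalerAl mulrA.
Qed.

Lemma cone_add x y : cone x -> cone y -> cone (x + y).
Proof.
move=> [xs [r xr]] [ys [s ysr]]; split; first by rewrite starD xs ys.
exists (r + s); rewrite realD opprD addrACA.
by rewrite (le_trans (cnormD _ _)) // lerD.
Qed.

Lemma coneZ r x : 0 <= r -> cone x -> cone (r%:C%C *: x).
Proof.
move=> r0 [xs [s xs']]; split; first by rewrite starZ_real xs.
exists (r * s); rewrite rmorphM -scalerA -scalerBr cnormZ_real ger0_norm //.
by rewrite ler_wpM2l.
Qed.

Lemma cone_sub x r : star x = x -> cnorm x <= r -> cone (r%:S - x).
Proof.
move=> xs xr; split; first by rewrite starB star_real xs.
by exists r; rewrite subKr.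
Qed.

Lemma cone_real r : cone (r%:S : A) <-> 0 <= r.
Proof.
split=> [[_ [s]]|r0]; last first.
  by split; [exact: star_real|exists r; rewrite subrr cnorm0].
by rewrite -realB cnorm_real ler_norml => /andP[_]; rewrite gerBl.
Qed.

(** Commuting self-adjoint roots [h] of [x] and [k] of [r - x] satisfy [h h + k k = r], hence
    [|x| <= |h|^2 <= r]. *)
Lemma cone_le x r : cone x -> cone (r%:S - x) -> cnorm x <= r.
Proof.
move=> cx crx.
have r0 : 0 <= r by apply/cone_real; rewrite -(subrK x r%:S); apply: cone_add.
have [h [hs hx hz]] := cone_sqrt cx; have [k [ks kx kz]] := cone_sqrt crx.
rewrite -hx (le_trans (cnormM _ _)) // -expr2 -[leRHS]ger0_norm //.
apply: (@cnorm_sqr_sum _ k) => //; last by rewrite hx kx addrC subrK.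
apply: kz; rewrite mulrBr mulrBl -scalerAr -scalerAl mulr1 mul1r -hx.
by rewrite mulrA.
Qed.

(** The norm of [x] works as a radius: [|x| - x] and [x + e] lie in the cone and add up to
    [|x| + e], so [cone_le] bounds the norm of the former by [|x| + e] for every [e]. *)
Lemma cone_closed x : star x = x -> (forall e, 0 < e -> cone (x + e%:S)) -> cone x.
Proof.
move=> xs xe; split=> //; exists (cnorm x); apply/ler_addgt0Pr => e e0.
have -> : (cnorm x)%:S - x = (cnorm x + e)%:S - (x + e%:S).
  by rewrite realD opprD addrACA subrr addr0.
apply: cone_le; last by rewrite subKr; exact: xe.
apply: cone_sub; first by have [] := xe _ e0.
by rewrite (le_trans (cnormD _ _)) // cnorm_real gtr0_norm.
Qed.

(* With [x + m] invertible and in the cone, write [x + m = h h]; then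
   [x + m - d = h (1 - d (x + m)^-1) h] is again a square for small [d]. *)
Lemma positive_cone x : positive_element x -> cone x.
Proof.
(* The least nonnegative shift [m] that brings [x] into the cone is attained, by closedness; it
   remains to exclude [m > 0]. *)
move=> [xs xpos]; pose E := [set e | 0 <= e /\ cone (x + e%:S)].
have E0 : E (cnorm x).
  split; first exact: cnorm_ge0.
  by rewrite addrC -[x]opprK; apply: cone_sub; rewrite ?starN ?xs ?cnormN.
have infE : has_inf E by split; [exists (cnorm x)|exists 0 => e []].
pose m := inf E; have m0 : 0 <= m by apply: lb_le_inf => [|e []//]; exists (cnorm x).
have cm : cone (x + m%:S).
  apply: cone_closed => [|d d0]; first by rewrite starD xs star_real.
  have [e [e0 ce] em] := inf_adherent d0 infE.
  rewrite -addrA -realD -(subrK e (m + d)) realD addrCA addrC.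
  by apply: cone_add ce _; apply/cone_real; rewrite subr_ge0 ltW.
have := m0; rewrite le_eqVlt => /predU1P[mE|m_gt0].
  by move: cm; rewrite -mE rmorph0 scale0r addr0.
have [z [yz zy]] : invertible (x + m%:S).
  have : invertible ((- m)%:S - x).
    apply: contrapT => /xpos; rewrite lecE /= => /andP[_].
    by rewrite oppr_ge0 leNgt m_gt0.
  rewrite rmorphN scaleNr -opprD addrC => -[z [yz zy]].
  by exists (- z); rewrite mulrN mulNr -mulNr -mulrN.
set y := x + m%:S in cm yz zy.
have ys : star y = y by case: cm.
have zs : star z = z.
  by rewrite -[LHS]mulr1 -yz mulrA -{1}ys -starM yz star1 mul1r.
have [h [hs hy hc]] := cone_sqrt cm.
have zh : z * h = h * z by apply: hc; rewrite yz zy.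
(* [d <= m] keeps the shift [m - d] nonnegative, and [d |z| <= 1] provides the square root of
   [1 - d z]. *)
pose d := Num.min m (cnorm z + 1)^-1.
have z1 : 0 < cnorm z + 1 by rewrite ltr_wpDl // cnorm_ge0.
have d0 : 0 < d by rewrite lt_min m_gt0 invr_gt0.
have dm : d <= m by rewrite ge_min lexx.
have [||w [ws ww wc]] := @sqrt_one_sub (d%:C%C *: z).
- by rewrite starZ_real zs.
- rewrite cnormZ_real gtr0_norm //.
  have : d * (cnorm z + 1) <= 1 by rewrite -ler_pdivlMr // div1r ge_min lexx orbT.
  apply: le_trans.
  by rewrite ler_pM2l // lerDl.
have hw : h * w = w * h by apply: wc; rewrite -scalerAr -scalerAl zh.
have : cone (x + (m - d)%:S).
  have -> : x + (m - d)%:S = h * w * (h * w).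
    rewrite -mulrA (mulrA w) -hw -mulrA mulrA hy ww mulrBr mulr1 -scalerAr yz.
    by rewrite realB addrA.
  by apply: cone_sqr; rewrite starM hs ws hw.
move=> cmd; have : m <= m - d by apply: ge_inf; [exact: infE.2|split; rewrite ?subr_ge0].
by rewrite leNgt ltrBlDr ltrDl d0.
Qed.

(** A negative real [l] satisfies [|l - r| > |x|], and a nonreal one is excluded by
    self-adjointness. Positivity of a state will be used on these elements. *)
Lemma positive_sub x r : star x = x -> cnorm x <= r -> positive_element (r%:S - x).
Proof.
move=> xs xr; split; first by rewrite /selfadjoint starB star_real xs.
move=> l; apply: contra_notP => l0.
have -> : l%:A - (r%:S - x) = (l - r%:C%C)%:A - - x.
  by rewrite scalerBl opprB opprK addrA addrAC.
have [l1|l1] := eqVneq (complex.Im l) 0; last first.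
  by apply: invertible_imag; rewrite ?starN ?xs //; case: l l0 l1 => ? ? /=; rewrite subr0.
apply: invertible_sub; rewrite cnormN normc_def.
case: l l0 l1 => s t /= l0 t0; move: l0; rewrite t0 subrr expr0n addr0 sqrtr_sqr.
rewrite lecE /= eqxx /= => /negP; rewrite -ltNge => s0.
have sr : s - r < 0 by rewrite subr_lt0 (lt_le_trans s0) // (le_trans (cnorm_ge0 x)).
by rewrite ltr0_norm // opprB (le_lt_trans xr) // ltrDl oppr_gt0.
Qed.

End Cone.

(** * Restriction of scalars, on an alias because the space keeps its complex structure *)

Definition realification (R : realType) (V : lmodType R[i]) : Type := V.

Section Realification.
Variables (R : realType) (V : lmodType R[i]).
Implicit Types (r s : R) (x y : realification V).

HB.instance Definition _ := GRing.Zmodule.copy (realification V) V.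

Let scale r x : realification V := r%:C%C *: (x : V).

Let scaleA r s x : scale r (scale s x) = scale (r * s) x.
Proof. by rewrite /scale scalerA rmorphM. Qed.

Let scale1 : left_id 1 scale.
Proof. by move=> x; rewrite /scale scale1r. Qed.

Let scaleDr : right_distributive scale +%R.
Proof. by move=> r x y; rewrite /scale scalerDr. Qed.

Let scaleDl x : {morph scale^~ x : r s / r + s}.
Proof. by move=> r s; rewrite /scale rmorphD scalerDl. Qed.

HB.instance Definition _ :=
  GRing.Zmodule_isLmodule.Build R (realification V) scaleA scale1 scaleDr scaleDl.

End Realification.

(** Both sums are extended by zero to the union, where the terms of the intersection cancel. *)
Lemma fset_sum_sub (I : choiceType) (V : zmodType) (A B : {fset I}) (f : I -> V) :
  \sum_(i <- A) f i - \sum_(i <- B) f i =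
  \sum_(i <- ((A `\` B) `|` (B `\` A))%fset) (if i \in A then f i else - f i).
Proof.
pose on (C : {fset I}) i := if i \in C then f i else 0.
have onE (C : {fset I}) : (C `<=` A `|` B)%fset ->
    \sum_(i <- C) f i = \sum_(i <- (A `|` B)%fset) on C i.
  move=> CAB; rewrite -(@big_fset_incl _ _ _ _ C _ (on C)) //; last first.
    by move=> i _ iC; rewrite /on (negbTE iC).
  by apply: eq_big_seq => i iC; rewrite /on iC.
rewrite !onE ?fsubsetUl ?fsubsetUr // -sumrB.
rewrite -(@big_fset_incl _ _ _ _ ((A `\` B) `|` (B `\` A))%fset); last first.
- move=> i _; rewrite !inE /on; case: (i \in A); case: (i \in B) => //= _.
  + by rewrite subrr.
  + by rewrite subrr.
- by apply/fsubsetP => i; rewrite !inE; case: (i \in A); case: (i \in B).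
apply: eq_big_seq => i; rewrite !inE /on.
by case: (i \in A); case: (i \in B) => //=; rewrite ?subr0 ?sub0r.
Qed.

(** * Self-adjoint parts, states and complexification *)

Section States.
Variables (R : realType) (A : unitalCstarAlgType R).
Implicit Types (x y : A) (f : A -> R).

Lemma cone0 : cone (0 : A).
Proof. by rewrite -(scale0r (1 : A)); apply/cone_real. Qed.

Lemma cone_sum (I : eqType) (s : seq I) (f : I -> A) :
  (forall i, i \in s -> cone (f i)) -> cone (\sum_(i <- s) f i).
Proof.
move=> sf; rewrite big_seq; apply: big_ind => //; [exact: cone0|exact: cone_add].
Qed.

Definition re_part x : A := (2^-1)%:C%C *: (x + star x).

Lemma star_re_part x : star (re_part x) = re_part x.
Proof. by rewrite starZ_real starD starK addrC. Qed.

Lemma re_partD x y : re_part (x + y) = re_part x + re_part y.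
Proof. by rewrite /re_part starD addrACA scalerDr. Qed.

Lemma re_partZ (r : R) x : re_part (r%:C%C *: x) = r%:C%C *: re_part x.
Proof. by rewrite /re_part starZ_real -scalerDr !scalerA mulrC. Qed.

Lemma re_part_id x : star x = x -> re_part x = x.
Proof.
move=> xs; rewrite /re_part xs scalerDr -scalerDl -rmorphD.
by rewrite -[2^-1]div1r -splitr scale1r.
Qed.

Lemma re_part_imag x : star x = x -> re_part ('i%C *: x) = 0.
Proof.
move=> xs; rewrite /re_part starZ xs -scalerDl.
have -> : ('i + 'i^*)%C = 0 :> R[i] by apply/eqP; rewrite eq_complex /= addr0 subrr !eqxx.
by rewrite scale0r scaler0.
Qed.

(** The state is evaluated at [|x| - x], whose spectrum is nonnegative. *)
Lemma state_le_cnorm (psi : A -> R[i]) x :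
  state psi -> star x = x -> complex.Re (psi x) <= cnorm x.
Proof.
move=> [psiL psi_ge0 psi1] xs.
have := psi_ge0 _ (positive_sub xs (lexx _)).
rewrite -[- x]scaleN1r addrC psiL -[(cnorm x)%:S]addr0 psiL psi1 mulr1 mulN1r.
have -> : psi 0 = 0 by have := psiL (-1) 0 0; rewrite scaler0 addr0 mulN1r addNr.
by rewrite addr0; case: (psi x) => s t; rewrite lecE /= => /andP[_]; rewrite addrC subr_ge0.
Qed.

(** For real linear [f], the unique complex linear functional with real part [f]. *)
Definition complexify f x : R[i] := (f x +i* - f ('i%C *: x))%C.

Lemma complexify_scalar f :
  (forall (r : R) x y, f (r%:C%C *: x + y) = r * f x + f y) -> scalar (complexify f).
Proof.
move=> fL; have fD x y : f (x + y) = f x + f y.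
  by rewrite -[x in LHS]scale1r (fL 1) mul1r.
have f0 : f 0 = 0 by have := fL (-1) 0 0; rewrite scaler0 addr0 mulN1r addNr.
have fZ (r : R) x : f (r%:C%C *: x) = r * f x by rewrite -[_ *: _]addr0 fL f0 addr0.
move=> [s t] x y.
have e : (s +i* t)%C *: x = s%:C%C *: x + t%:C%C *: ('i%C *: x).
  rewrite scalerA -scalerDl; congr (_ *: _).
  by apply/eqP; rewrite eq_complex /=; apply/andP; split; apply/eqP; ring.
have ie : 'i%C *: ((s +i* t)%C *: x) = s%:C%C *: ('i%C *: x) + (- t)%:C%C *: x.
  rewrite !scalerA -scalerDl; congr (_ *: _).
  by apply/eqP; rewrite eq_complex /=; apply/andP; split; apply/eqP; ring.
rewrite /complexify scalerDr ie e !fD !fZ.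
by apply/eqP; rewrite eq_complex /=; apply/andP; split; apply/eqP; ring.
Qed.

End States.

(** * Ergodic averages and their almost invariance *)

Section ErgodicAverage.
Variables (R : realType) (A : unitalCstarAlgType R) (G : groupType).
Variable Theta : G -> A -> A.
Hypothesis dyn : Cstar_dynamical_system Theta.
Implicit Types (F : {fset G}) (x y : A) (g : G).

Local Notation avg := (ergodic_average Theta).

Lemma ThetaL g : linear (Theta g).
Proof. by have [_ ? _ _ _] := dyn.1 g. Qed.

Lemma ThetaD g x y : Theta g (x + y) = Theta g x + Theta g y.
Proof. by rewrite -[x in LHS]scale1r ThetaL scale1r. Qed.

Lemma ThetaZ g (c : R[i]) x : Theta g (c *: x) = c *: Theta g x.
Proof.
have T0 : Theta g 0 = 0.
  by have := ThetaL g (-1) 0 0; rewrite scaler0 addr0 scaleN1r addNr.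
by rewrite -[_ *: _ in LHS]addr0 ThetaL T0 addr0.
Qed.

Lemma ThetaN g x : Theta g (- x) = - Theta g x.
Proof. by rewrite -scaleN1r ThetaZ scaleN1r. Qed.

Lemma ThetaB g x y : Theta g (x - y) = Theta g x - Theta g y.
Proof. by rewrite ThetaD ThetaN. Qed.

Lemma Theta_star g x : Theta g (star x) = star (Theta g x).
Proof. by have [_ _ _ _ ->] := dyn.1 g. Qed.

Lemma Theta_real g (r : R) : Theta g r%:S = r%:S.
Proof. by rewrite ThetaZ; have [_ _ -> _ _] := dyn.1 g. Qed.

(** The cone consists of the squares of self-adjoint elements, which automorphisms preserve. *)
Lemma Theta_cone g x : cone x -> cone (Theta g x).
Proof.
move=> /cone_sqrt[h [hs <- _]]; have [_ _ _ -> _] := dyn.1 g.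
by apply: cone_sqr; rewrite -Theta_star hs.
Qed.

Lemma avgE F x : avg F x = (#|` F|%:R^-1)%:C%C *: \sum_(g <- F) Theta g x.
Proof. by rewrite /ergodic_average fmorphV rmorph_nat. Qed.

Lemma avgL F : linear (avg F).
Proof.
move=> c x y; rewrite /ergodic_average /= [in RHS]scalerA mulrC -scalerA -scalerDr; congr (_ *: _).
by rewrite scaler_sumr -big_split; apply: eq_bigr => g _; rewrite ThetaL.
Qed.

Lemma avgD F x y : avg F (x + y) = avg F x + avg F y.
Proof. by rewrite -[x in LHS]scale1r avgL scale1r. Qed.

Lemma avg0 F : avg F 0 = 0.
Proof. by have := avgL F (-1) 0 0; rewrite scaler0 addr0 scaleN1r addNr. Qed.

Lemma avgZ F (c : R[i]) x : avg F (c *: x) = c *: avg F x.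
Proof. by rewrite -[_ *: _ in LHS]addr0 avgL avg0 addr0. Qed.

Lemma avgN F x : avg F (- x) = - avg F x.
Proof. by rewrite -scaleN1r avgZ scaleN1r. Qed.

Lemma avg_const F x : F != fset0 -> (forall g, Theta g x = x) -> avg F x = x.
Proof.
move=> F0 Tx; rewrite /ergodic_average (eq_bigr (fun=> x)) => [|g _]; last exact: Tx.
rewrite big_const_seq count_predT iter_addr_0 -[x *+ _](@scaler_nat R[i]) scalerA mulVf ?scale1r //.
by rewrite pnatr_eq0 cardfs_eq0.
Qed.

Lemma avg_real F (r : R) : F != fset0 -> avg F r%:S = r%:S.
Proof. by move=> F0; apply: avg_const => // g; apply: Theta_real. Qed.

Lemma avg_cone F x : cone x -> cone (avg F x).
Proof.
move=> cx; rewrite avgE; apply: coneZ; first by rewrite invr_ge0.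
by apply: cone_sum => g _; apply: Theta_cone.
Qed.

Lemma star_avg F x : star x = x -> star (avg F x) = avg F x.
Proof.
move=> xs; rewrite avgE starZ_real; congr (_ *: _).
rewrite (big_morph star (@starD R A) (star0 A)).
by apply: eq_bigr => g _; rewrite -Theta_star xs.
Qed.

Lemma cone_sub_avg F x (r : R) :
  F != fset0 -> cone (r%:S - x) -> cone (r%:S - avg F x).
Proof.
by move=> F0 /(avg_cone F); rewrite avgD avgN avg_real.
Qed.

(* The averages of [Theta g x] and of [x] differ by a sum over the symmetric
   difference of [F g] and [F]. *)
Lemma cone_avg_shift F g x : star x = x ->
  cone ((cnorm x * (#|` fsymdiff (right_translate F g) F|%:R / #|` F|%:R))%:S
        - avg F (Theta g x - x)).
Proof.
move=> xs; set D := fsymdiff _ _.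
have -> : avg F (Theta g x - x) = (#|` F|%:R^-1)%:C%C *:
    \sum_(h <- D) (if h \in right_translate F g then Theta h x else - Theta h x).
  rewrite avgE -fset_sum_sub; congr (_ *: _).
  rewrite (eq_bigr _ (fun h _ => ThetaB h _ _)) sumrB; congr (_ - _).
  (* [Theta h \o Theta g] is [Theta (h * g)], and right multiplication is injective, so the first
     sum runs over the translate of [F]. *)
  rewrite big_imfset /=; last by move=> h k _ _; apply: mulIg.
  by apply: eq_bigr => h _; rewrite dyn.2.
rewrite mulrA mulrC rmorphM -scalerA -scalerBr.
apply: coneZ; first by rewrite invr_ge0.
(* The constant splits into one [cnorm x] for each [h] in [D], which dominates [Theta h x] with
   either sign. *)
have -> : (cnorm x * #|` D|%:R)%:S = \sum_(h <- D) (cnorm x)%:S :> A.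
  by rewrite big_const_seq count_predT iter_addr_0 mulr_natr rmorphMn scalerMnl.
rewrite -sumrB; apply: cone_sum => h _.
have cx : cone ((cnorm x)%:S - Theta h x).
  by rewrite -(Theta_real h) -ThetaB; apply/Theta_cone/cone_sub.
have cNx : cone ((cnorm x)%:S + Theta h x).
  rewrite -(Theta_real h) -ThetaD; apply: Theta_cone.
  by rewrite -[x in _ + x]opprK; apply: cone_sub; rewrite ?starN ?xs ?cnormN.
by case: ifP; rewrite ?opprK.
Qed.

Lemma invariant_state_le (psi : A -> R[i]) F x :
  F != fset0 -> star x = x -> invariant_states Theta psi ->
  complex.Re (psi x) <= cnorm (avg F x).
Proof.
move=> F0 xs [psiS psiT].
suff -> : psi x = psi (avg F x) by apply: state_le_cnorm => //; apply: star_avg.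
have [psiL _ _] := psiS.
have psi0 : psi 0 = 0 by have := psiL (-1) 0 0; rewrite scaler0 addr0 mulN1r addNr.
have psiD y z : psi (y + z) = psi y + psi z.
  by rewrite -[y in LHS]scale1r psiL mul1r.
rewrite /ergodic_average -[_ *: _]addr0 psiL psi0 addr0 (big_morph psi psiD psi0).
rewrite (eq_bigr (fun=> psi x)) => [|g _]; last by rewrite -[in RHS](psiT g).
rewrite big_const_seq count_predT iter_addr_0 -[psi x *+ _]mulr_natl mulrA mulVf ?mul1r //.
by rewrite pnatr_eq0 cardfs_eq0.
Qed.

End ErgodicAverage.

(** * The upper average and the invariant states it produces *)

Section UpperAverage.
Variables (R : realType) (A : unitalCstarAlgType R) (G : groupType).
Variables (Theta : G -> A -> A) (F : nat -> {fset G}).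
Hypothesis dyn : Cstar_dynamical_system Theta.
Hypothesis folner : right_Folner R F.
Implicit Types (x y : A).

Local Notation avg k := (ergodic_average Theta (F k)).

(** Upper bounds of the spectrum are expressed by the cone order, and a limsup is the infimum of the
    eventual bounds. The real part makes sense of this for every [x]. *)
Definition eventual_bound x : set R :=
  [set t | \forall k \near \oo, cone (t%:S - avg k (re_part x))].

(* [upper_avg x] is the limsup of the largest spectral value of [avg k (re_part x)]. *)
Definition upper_avg x : R := inf (eventual_bound x).

Lemma eventual_bound_cnorm x : eventual_bound x (cnorm (re_part x)).
Proof.
apply: nearW => k; apply: cone_sub_avg => //; first exact: folner.1.
by apply: cone_sub => //; exact: star_re_part.
Qed.

Lemma upper_avg_le x t : eventual_bound x t -> upper_avg x <= t.
Proof.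
(* The infimum is genuine: at a suitable [k], adding [s - avg] and [|Re x| + avg] gives
   [0 <= s + |Re x|]. *)
apply: ge_inf; exists (- cnorm (re_part x)) => s xs.
have [k ck] := filter_ex xs.
have : cone ((cnorm (re_part x))%:S - avg k (- re_part x)).
  apply: cone_sub_avg => //; first exact: folner.1.
  by apply: cone_sub; rewrite ?starN ?star_re_part ?cnormN.
move=> /(cone_add ck); rewrite avgN // opprK addrACA addNr addr0 -realD => /cone_real.
by rewrite -lerBlDr sub0r.
Qed.

Lemma le_upper_avg x b : (forall t, eventual_bound x t -> b <= t) -> b <= upper_avg x.
Proof.
by move=> xb; apply: lb_le_inf xb; exists (cnorm (re_part x)); exact: eventual_bound_cnorm.
Qed.

Lemma upper_avg_sublinear : @sublinear R (realification A) upper_avg.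
Proof.
split=> [x y|r x r0].
  rewrite -lerBlDr; apply: le_upper_avg => t xt; rewrite lerBlDr -lerBlDl.
  apply: le_upper_avg => s ys; rewrite lerBlDl; apply: upper_avg_le.
  apply: filterS2 xt ys => k ct cs.
  by rewrite (re_partD (x : A) y) avgD // realD opprD addrACA; apply: cone_add.
have rE : re_part (r *: x : realification A) = r%:C%C *: re_part (x : A).
  exact: re_partZ.
have [r00|rn0] := eqVneq r 0.
  rewrite r00 mul0r; apply: upper_avg_le; apply: nearW => k.
  rewrite -r00 rE r00 rmorph0 !scale0r avg0 // subr0; exact: cone0.
have r_gt0 : 0 < r by rewrite lt_neqAle eq_sym rn0.
rewrite mulrC -ler_pdivrMr //; apply: le_upper_avg => t; rewrite ler_pdivrMr // => xt.
apply: upper_avg_le; apply: filterS xt => k ck.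
rewrite rE avgZ // mulrC rmorphM -scalerA -scalerBr; exact: coneZ.
Qed.

(** This makes every linear functional below [upper_avg] nonnegative on the cone. *)
Lemma upper_avg_opp_cone x : cone x -> upper_avg (- x) <= 0.
Proof.
move=> cx; apply: upper_avg_le; apply: nearW => k.
rewrite re_part_id; last by rewrite starN cx.1.
by rewrite rmorph0 scale0r avgN // opprK add0r; apply: avg_cone.
Qed.

(** This makes linear functionals below [upper_avg] invariant. By [cone_avg_shift] the averages are
    bounded by a multiple of the Folner ratio, which tends to 0. *)
Lemma upper_avg_shift g x : upper_avg (Theta g x - x) <= 0.
Proof.
apply/ler_addgt0Pl => e e0; rewrite addr0.
have -> : upper_avg (Theta g x - x) = upper_avg (Theta g (re_part x) - re_part x).
  have reT y : re_part (Theta g y - y) = Theta g (re_part y) - re_part y.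
    by rewrite /re_part ThetaZ // ThetaD // Theta_star // starB addrACA -opprD scalerBr.
  by rewrite /upper_avg /eventual_bound !reT (re_part_id (star_re_part x)).
set y := re_part x; have ys : star y = y by exact: star_re_part.
(* The Folner ratio is taken below [e / (|y| + 1)], since [|y|] may vanish. *)
have y1 : 0 < cnorm y + 1 by rewrite ltr_wpDl // cnorm_ge0.
apply: upper_avg_le; have /cvgrPdist_le/(_ _ (divr_gt0 e0 y1)) := folner.2 g.
apply: filterS => k; rewrite sub0r normrN ger0_norm ?divr_ge0 //.
rewrite ler_pdivlMr // => De.
rewrite re_part_id; last by rewrite starB -Theta_star // ys.
have := cone_avg_shift dyn (F k) g ys; set d := _ / _ in De *.
have : cone ((e - cnorm y * d)%:S : A).
  apply/cone_real; rewrite subr_ge0; apply: le_trans De.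
  by rewrite mulrC ler_wpM2l ?lerDl // divr_ge0.
by move=> c1 /(cone_add c1); rewrite realB addrA subrK.
Qed.

Lemma exists_invariant_state a : cone a ->
  exists2 phi, invariant_states Theta phi & complex.Re (phi a) = upper_avg a.
Proof.
move=> ca; have [f [fL fq fa]] := @hahn_banach R (realification A) _ a upper_avg_sublinear.
have {}fL (r : R) (x y : A) : f (r%:C%C *: x + y) = r * f x + f y := fL r x y.
have fN (x : A) : f (- x) = - f x.
  have f0 : f 0 = 0 by have := fL (-1) 0 0; rewrite scaler0 addr0 mulN1r addNr.
  by have := fL (-1) x 0; rewrite rmorphN1 scaleN1r mulN1r f0 !addr0.
have f_ge0 (x : A) : cone x -> 0 <= f x.
  by move=> cx; rewrite -oppr_le0 -fN (le_trans (fq _)) // upper_avg_opp_cone.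
have fB (x y : A) : f (x - y) = f x - f y.
  by have := fL 1 x (- y); rewrite scale1r mul1r fN.
(* Applied to [i x] and [- i x], this shows that [f] kills [i x] for self-adjoint [x], so that the
   complexification is real there. *)
have f_le0 (x : A) : re_part x = 0 -> f x <= 0.
  move=> x0; rewrite (le_trans (fq x)) //; apply: upper_avg_le; apply: nearW => k.
  by rewrite x0 avg0 // rmorph0 scale0r subr0; exact: cone0.
have fi (x : A) : star x = x -> f ('i%C *: x) = 0.
  move=> xs; apply/eqP; rewrite eq_le f_le0 ?re_part_imag //= -oppr_le0 -fN.
  by rewrite -scalerN f_le0 // re_part_imag // starN xs.
(* The inequality at [- x] is the reverse one at [x]. *)
have fT g (x : A) : f (Theta g x) = f x.
  have le (y : A) : f (Theta g y) <= f y.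
    by rewrite -subr_le0 -fB (le_trans (fq _)) // upper_avg_shift.
  apply/eqP; rewrite eq_le le /= -lerN2 -!fN.
  by rewrite -ThetaN.
(* Scalars are their own averages; domination at 1 and at -1 pins the value down. *)
have f1 : f 1 = 1.
  have re1 : re_part (1 : A) = 1 by rewrite re_part_id // star1.
  have bound (r : R) : upper_avg (r%:S : A) <= r.
    apply: upper_avg_le; apply: nearW => k.
    rewrite re_partZ re1 avg_real // ?subrr; [exact: cone0|exact: folner.1].
  have le1 (r : R) : f (r%:S : A) <= r := le_trans (fq _) (bound r).
  apply/eqP; rewrite eq_le; have := le1 1; rewrite scale1r => -> /=.
  by have := le1 (-1); rewrite rmorphN1 scaleN1r fN lerN2.
exists (complexify f); last exact: fa.
split; last by move=> g; apply/funext => x /=; rewrite /complexify -ThetaZ // !fT.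
split; first exact: complexify_scalar.
- move=> x /positive_cone cx; rewrite lecE /= fi ?oppr0 ?eqxx //=; last by case: cx.
  exact: f_ge0.
- by rewrite /complexify fi ?star1 // f1 oppr0.
Qed.

End UpperAverage.

(** * Convergence of the norms to the supremum *)

Theorem theorem3p4 (R : realType) (A : unitalCstarAlgType R) (G : groupType)
    (Theta : G -> A -> A) (F : nat -> {fset G}) (a : A) :
  separable (normed_space A) ->
  countable [set: G] ->
  amenable R G ->
  Cstar_dynamical_system Theta ->
  right_Folner R F ->
  positive_element a ->
  (fun k => cnorm (ergodic_average Theta (F k) a)) @ \oo -->
    m_sup a (invariant_states Theta).
Proof.
move=> _ _ _ dyn folner /positive_cone ca.
have as_ : star a = a by case: ca.
have [phi phiS phia] := exists_invariant_state dyn folner ca.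
have le_avg k psi : invariant_states Theta psi ->
    complex.Re (psi a) <= cnorm (ergodic_average Theta (F k) a).
  by apply: invariant_state_le => //; exact: folner.1.
have phi_le : upper_avg Theta F a <= m_sup a (invariant_states Theta).
  rewrite -phia; apply: ub_le_sup; last by exists phi.
  (* The norm of a single average bounds all these values, so the supremum is genuine. *)
  by exists (cnorm (ergodic_average Theta (F 0%N) a)) => _ [psi psiS <-]; apply: le_avg.
apply/cvgrPdist_le => e e0.
have infU : has_inf (eventual_bound Theta F a).
  split; first by exists (cnorm (re_part a)); exact: eventual_bound_cnorm.
  by exists (upper_avg Theta F a) => t; exact: upper_avg_le.
(* An eventual bound [t] within [e] of the upper average bounds the norms too: by [cone_le], since
   the averages of [a] lie in the cone. *)
have [t at_ te] := inf_adherent e0 infU.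
apply: filterS at_ => k; rewrite re_part_id // => ck.
have /le_trans kt := cone_le (avg_cone dyn (F k) ca) ck.
(* Every average has norm at least the supremum, so only the upper estimate remains. *)
rewrite distrC ger0_norm; last first.
  rewrite subr_ge0; apply: ge_sup; first by exists (complex.Re (phi a)), phi.
  by move=> _ [psi psiS <-]; apply: le_avg.
by rewrite lerBlDl kt // (le_trans (ltW te)) // lerD2r.
Qed.
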